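(* Let $k$ be a fixed constant. Then for every function $m(n)$, $$\limsup_{n\to\infty}\mathbf{P}[P_{n,m}\text{ contains a component of order at most } k \text{ that contains a cycle}]<1.$$
   Context: $\mathcal{P}(n,m)$ is the set of simple labelled planar graphs on vertex set $\{1,\ldots,n\}$ with exactly $m$ edges; $P_{n,m}$ is chosen uniformly at random from $\mathcal{P}(n,m)$. *)

(* Defs.v *)
From mathcomp Require Import all_boot all_order all_algebra.
From mathcomp Require Import all_classical all_reals all_analysis.

Set Implicit Arguments.
Unset Strict Implicit.
Unset Printing Implicit Defensive.

Import Order.TTheory GRing.Theory Num.Theory.
Import numFieldNormedType.Exports.

(* A graph on the vertex set T is given by its set of edges E : {set {set T}};
   it is simple when every edge has exactly two elements, so that
   [set x; y] \in E forces x != y. *)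

Section Graphs.
Variable T : finType.
Implicit Types (E : {set {set T}}) (x y : T).

Definition simple_graph E : bool := [forall e in E, #|e| == 2].

Definition adj E : rel T := [rel x y | [set x; y]%SET \in E].

Definition component E x : {set T} := [set y | connect (adj E) x y]%SET.

Definition contains_cycle E (A : {set T}) : Prop :=
  exists c : seq T,
    [/\ (2 < size c)%N, uniq c, cycle (adj E) c & {subset c <= A}].

Definition has_small_cyclic_component (k : nat) E : Prop :=
  exists x, (#|component E x| <= k)%N /\ contains_cycle E (component E x).

Local Open Scope ring_scope.

(* [plane_drawing E p a]: vertices are distinct points of the plane; every edge
   e is drawn as the simple arc t |-> a e t, 0 <= t <= 1, whose two endpoints
   are the images of the two ends of e; the interior of an arc contains neither
   a vertex nor a point of another arc. *)
Definition plane_drawing (R : realType) E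
    (p : T -> R * R) (a : {set T} -> R -> R * R) : Prop :=
  [/\ injective p,
      (forall e, e \in E ->
         [/\ {within `[0, 1], continuous (a e)}%classic,
             {in `[0, 1] &, injective (a e)}
           & (p @` [set v | v \in e] = [set a e 0; a e 1])%classic]),
      (forall e v (t : R), e \in E -> 0 < t < 1 -> a e t <> p v)
    & (forall e f (s t : R), e \in E -> f \in E -> e != f ->
         0 < s < 1 -> 0 <= t <= 1 -> a e s <> a f t)].

Definition planar (R : realType) E : Prop :=
  exists (p : T -> R * R) (a : {set T} -> R -> R * R), plane_drawing E p a.

End Graphs.

(* The vertices 1, ..., n are encoded as the elements of 'I_n. *)
Definition planar_graphs (R : realType) (n m : nat) : {set {set {set 'I_n}}} :=
  [set E | [&& simple_graph E, #|E| == m & `[< planar R E >]]]%SET.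

(* Probability of Q for a uniformly random element of S; it is 0 when S is
   empty, since then the quotient is 0 / 0. *)
Definition prob_unif (R : realType) (U : finType) (S : {set U})
    (Q : U -> Prop) : R :=
  (#|[set x in S | `[< Q x >]]%SET|%:R / #|S|%:R)%R.

(* Main.v *)
(** Call an edge xy of G cyclic if it lies on a cycle and its component has at
most k vertices. For such an edge and a vertex v outside the component of x, the
switch G - xy + xv is again planar with the same number of edges, and has
strictly fewer cyclic edges. There are at least n - k choices of v for each
cyclic edge. Conversely, given the new graph, x can be chosen in n ways, but then
xv cuts off at most k vertices on the side of x, which leaves at most k + 1
choices for v and k for y. Hence the mean number of cyclic edges is bounded, and
the graphs with i + 1 cyclic edges are at most a constant times as many as those
with at most i. So a positive proportion of all graphs has no cyclic edge.

Adding an edge xv between two components keeps planarity because a drawing can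
be moved into a half-plane with a prescribed vertex alone on the boundary: the
two components are drawn in disjoint half-planes, with x and v facing each
other. *)

Require Import Defs.
From mathcomp Require Import all_boot all_order all_algebra.
From mathcomp Require Import all_classical all_reals all_analysis.
From mathcomp Require Import ring lra zify.

Set Implicit Arguments.
Unset Strict Implicit.
Unset Printing Implicit Defensive.

Import Order.TTheory GRing.Theory Num.Theory.
Import numFieldNormedType.Exports.

(** * Real-analysis preliminaries on arcs *)

Section PlaneDrawings.
Context {R : realType}.
Local Open Scope classical_set_scope.
Local Open Scope ring_scope.

Lemma continuous_comp_within (S T U : topologicalType) (A : set T)
    (f : T -> U) (g : S -> T) :
  {within A, continuous f} -> continuous g -> (forall s, A (g s)) ->
  continuous (f \o g).
Proof.
move=> /subspace_continuousP cf cg Ag s.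
have cAg : g @ s --> within A (nbhs (g s)).
  move=> V wV; have : nbhs s (fun z => A (g z) -> V (g z)) := cg s _ wV.
  by apply: (@filterS _ (nbhs s)) => z; apply.
exact: cvg_comp cAg (cf _ (Ag s)).
Qed.

(** The last exit is the maximum of the compact set of times in [[0, 1]] at which [g] is at most
    [r]. *)
Lemma last_exit (g : R -> R) (r : R) :
  continuous g -> g 0 < r < g 1 ->
  exists t, [/\ 0 < t < 1, g t = r & forall s, t < s <= 1 -> r < g s].
Proof.
move=> cg /andP[g0 g1].
pose A : set R := `[0, 1] `&` g @^-1` [set x | x <= r].
have A0 : A 0 by split; rewrite /= ?in_itv/= ?lexx ?ler01// ltW.
have cA : compact A.
  apply: compact_closedI; first exact: segment_compact.
  by apply: preimage_closed; [move=> x _; exact: cg | exact: closed_le].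
have [|c] := compact_EVT_max (f := id) (ex_intro _ _ A0) cA.
  by apply: continuous_subspaceT => x.
rewrite inE => -[/=]; rewrite in_itv /= => /andP[c0 c1] gc cmax.
have gs s : c < s <= 1 -> r < g s.
  case/andP=> cs s1; rewrite ltNge; apply/negP => gsr.
  suff /cmax : s \in A by rewrite leNgt cs.
  by rewrite inE; split => //=; rewrite in_itv /= s1 (le_trans c0 (ltW cs)).
have clt1 : c < 1 by rewrite lt_neqAle c1 andbT; apply: contraTneq gc => ->; rewrite -ltNge.
(* A time [d >= c] with value [r] lies in [A], so maximality of [c] forces [d = c] and hence
   [g c = r]. *)
have [||d] := @IVT R g c 1 r c1.
- exact: continuous_subspaceT.
- by rewrite ge_min gc /= le_max (ltW g1) orbT.
rewrite in_itv /= => /andP[cd d1] gd.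
have : d \in A.
  by rewrite inE; split; rewrite /= ?gd//in_itv/= d1 (le_trans c0 cd).
move=> /cmax dc; have {dc cd}dc : d = c by apply/eqP; rewrite eq_le dc cd.
rewrite dc in gd; exists c; split=> //; rewrite clt1 andbT lt_neqAle c0 andbT.
by apply: contraTneq g0 => ->; rewrite gd ltxx.
Qed.

Lemma positive_lower_bound (g : R -> R) :
  continuous g -> (forall t, 0 <= t <= 1 -> 0 < g t) ->
  exists2 r, 0 < r & forall t, 0 <= t <= 1 -> r < g t.
Proof.
move=> cg gpos.
have [|c /itvP c01 cmin] := @EVT_min R g 0 1 ler01.
  exact: continuous_subspaceT.
have gc : 0 < g c by rewrite gpos ?c01.
exists (g c / 2); first by rewrite divr_gt0.
move=> t t01; apply: lt_le_trans (cmin t _); last by rewrite in_itv.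
by rewrite ltr_pdivrMr// ltr_pMr// ltr1n.
Qed.

(** The minimum of the finitely many individual bounds serves all indices; starting it at 1 covers
    an empty [I]. *)
Lemma common_lower_bound (I : finType) (P : I -> R -> Prop) :
  (forall i r s, s <= r -> P i r -> P i s) ->
  (forall i, exists2 r, 0 < r & P i r) ->
  exists2 r, 0 < r & forall i, P i r.
Proof.
move=> Pmono Pex.
have /boolp.choice[f fP] : forall i, exists r, 0 < r /\ P i r.
  by move=> i; have [r] := Pex i; exists r.
exists (\big[Num.min/1]_i f i).
  by elim/big_ind: _ => [|x y x0 y0|i _]; rewrite ?lt_min ?x0//; have [] := fP i.
by move=> i; apply: Pmono (fP i).2; exact: bigmin_le_cond.
Qed.

(** Pigeonhole on [size s + 1] distinct inverses of positive integers. This supplies a slope that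
    avoids finitely many directions. *)
Lemma exists_notin (s : seq R) : exists2 x, 0 <= x <= 1 & x \notin s.
Proof.
pose u : seq R := [seq i.+1%:R^-1 | i <- iota 0 (size s).+1].
have uu : uniq u.
  rewrite map_inj_uniq ?iota_uniq// => i j /invr_inj /eqP.
  by rewrite eqr_nat => /eqP[].
have [/allP us|/allPn[x xu xs]] := boolP (all (mem s) u).
  by have := uniq_leq_size uu us; rewrite size_map size_iota ltnn.
exists x => //; case/mapP: xu => i _ ->.
by rewrite invr_ge0 ler0n invf_le1 ?ltr0n// ler1n.
Qed.

(** Retraction onto the unit interval: precomposing with it turns an arc continuous within [[0, 1]]
    into one continuous on the whole line. *)
Definition clamp01 (t : R) : R := Num.max 0 (Num.min 1 t).

Lemma clamp01_itv t : 0 <= clamp01 t <= 1.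
Proof.
by rewrite /clamp01 le_max lexx /= ge_max ler01 ge_min lexx.
Qed.

Lemma clamp01_id t : 0 <= t <= 1 -> clamp01 t = t.
Proof. by move=> /andP[t0 t1]; rewrite /clamp01 min_r// max_r. Qed.

Lemma continuous_minr (f g : R -> R) :
  continuous f -> continuous g -> continuous (fun x => Num.min (f x) (g x)).
Proof. by move=> cf cg x; apply: continuous_min; [exact: cf | exact: cg]. Qed.

Lemma continuous_maxr (f g : R -> R) :
  continuous f -> continuous g -> continuous (fun x => Num.max (f x) (g x)).
Proof. by move=> cf cg x; apply: continuous_max; [exact: cf | exact: cg]. Qed.

Lemma continuous_clamp01 : continuous clamp01.
Proof.
apply: continuous_maxr => [x|]; first exact: cvg_cst.
by apply: continuous_minr => x; [exact: cvg_cst | exact: cvg_id].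
Qed.

End PlaneDrawings.

(** * Making a vertex accessible along a straight segment *)

Section Straightening.
Context {R : realType} {T : finType}.
Implicit Types (E : {set {set T}}) (p : T -> R * R) (a : {set T} -> R -> R * R).
Local Open Scope classical_set_scope.
Local Open Scope ring_scope.

Lemma planar_sub E E' : E' \subset E -> planar R E -> planar R E'.
Proof.
move=> /fintype.subsetP sE [p [a [ip ha hv hd]]]; exists p, a; split=> //.
- by move=> e /sE; apply: ha.
- by move=> e v t /sE; apply: hv.
- by move=> e f s t /sE eE /sE fE; apply: hd.
Qed.

Lemma plane_drawing_ext E p a a' :
  (forall e t, e \in E -> 0 <= t <= 1 -> a e t = a' e t) ->
  plane_drawing E p a -> plane_drawing E p a'.
Proof.
move=> aa' [ip ha hv hd]; split=> //.
- move=> e eE; have [ca ia pa] := ha e eE; split.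
  + apply: subspace_eq_continuous ca => t.
    by rewrite inE /= in_itv /= => t01; apply: aa'.
  + by move=> s t s01 t01; rewrite -!aa' //; apply: ia.
  + by rewrite -!aa' ?lexx ?ler01.
- move=> e v t eE t01; rewrite -aa' //; first exact: hv.
  by case/andP: t01 => /ltW -> /ltW ->.
- move=> e f s t eE fE ef s01 t01; rewrite -!aa' //; first exact: hd.
  by case/andP: s01 => /ltW -> /ltW ->.
Qed.

(** The region [D] is there because the map that opens a slit plane is guaranteed to be injective
    and continuous only off the slit. *)
Lemma plane_drawing_comp E p a (D : R * R -> Prop) (psi : R * R -> R * R) :
  plane_drawing E p a -> (forall y, D (p y)) ->
  (forall e t, e \in E -> 0 <= t <= 1 -> D (a e t)) ->
  (forall z w, D z -> D w -> psi z = psi w -> z = w) ->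
  (forall z, D z -> {for z, continuous psi}) ->
  plane_drawing E (psi \o p) (fun e => psi \o a e).
Proof.
move=> [ip ha hv hd] Dp Da ipsi cpsi; split.
- by move=> y z /= /ipsi yz; apply: ip; apply: yz.
- move=> e eE; have [ca ia pa] := ha e eE; split.
  + apply/subspace_continuousP => t /= t01.
    move/subspace_continuousP: ca => /(_ t t01) ca.
    by apply: cvg_comp ca _; apply: cpsi; apply: Da => //; rewrite in_itv in t01.
  + move=> s t s01 t01 /= /ipsi st; apply: ia => //; apply: st; exact: Da.
  + by rewrite -image_comp pa image_setU !image_set1.
- move=> e v t eE t01 /= /ipsi; apply/not_implyP; split.
    by apply: Da => //; case/andP: t01 => /ltW -> /ltW ->.
  by apply/not_implyP; split=> //; apply: hv.
- move=> e f s t eE fE ef s01 t01 /= /ipsi; apply/not_implyP; split.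
    by apply: Da => //; case/andP: s01 => /ltW -> /ltW ->.
  by apply/not_implyP; split; [apply: Da | apply: hd].
Qed.

Lemma drawing_ends E p a e : plane_drawing E p a -> e \in E ->
  [/\ exists2 y, y \in e & a e 0 = p y, exists2 y, y \in e & a e 1 = p y
    & forall y, y \in e -> a e 0 = p y \/ a e 1 = p y].
Proof.
move=> [ip ha hv hd] eE; have [ca ia pa] := ha e eE; split.
- have : (p @` [set v | v \in e]) (a e 0) by rewrite pa; left.
  by case=> y /= ye <-; exists y.
- have : (p @` [set v | v \in e]) (a e 1) by rewrite pa; right.
  by case=> y /= ye <-; exists y.
- move=> y ye; have : (p @` [set v | v \in e]) (p y) by exists y.
  by rewrite pa => -[] ->; [left | right].
Qed.

(** Arcs at [v] that start at their other end are reversed, so that every arc at [v] leaves from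
    [p v]. *)
Lemma oriented_drawing E v : planar R E ->
  exists p a, [/\ plane_drawing E p a, (forall e, e \in E -> continuous (a e))
    & forall e, e \in E -> v \in e -> a e 0 = p v].
Proof.
move=> [p [a0 dr0]].
pose a e := a0 e \o clamp01.
have dr : plane_drawing E p a.
  by apply: plane_drawing_ext dr0 => e t eE t01; rewrite /a /= clamp01_id.
have ca e : e \in E -> continuous (a e).
  move=> eE; have [_ /(_ e eE)[ca0 _ _] _ _] := dr0.
  apply: continuous_comp_within ca0 continuous_clamp01 _ => t.
  by rewrite /= in_itv /= clamp01_itv.
pose c (e : {set T}) := (v \in e) && (a e 0 != p v).
pose sg e (t : R) : R := if c e then 1 - t else t.
have sgO e t : 0 < t < 1 -> 0 < sg e t < 1 by rewrite /sg; case: (c e) => //; lra.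
have sgC e t : 0 <= t <= 1 -> 0 <= sg e t <= 1 by rewrite /sg; case: (c e) => //; lra.
have sgI e s t : sg e s = sg e t -> s = t by rewrite /sg; case: (c e) => //; lra.
exists p, (fun e => a e \o sg e); split.
- have [ip ha hv hd] := dr; split=> //.
  + move=> e eE; have [_ ia pa] := ha e eE; split.
    * apply: continuous_subspaceT => t; apply: continuous_comp; last exact: ca.
      rewrite /sg; case: (c e); last exact: cvg_id.
      by apply: cvgB; [exact: cvg_cst | exact: cvg_id].
    * move=> s t; rewrite !in_itv => s01 t01 /= /ia st; apply: (sgI e); apply: st.
        by rewrite in_itv sgC.
      by rewrite in_itv sgC.
    * by rewrite pa /= /sg; case: (c e); rewrite ?subrr ?subr0// setUC.
  + by move=> e y t eE /(sgO e) t01; apply: hv.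
  + by move=> e f s t eE fE ef /(sgO e) s01 /(sgC f) t01; apply: hd.
- move=> e eE t; apply: continuous_comp; last exact: ca.
  rewrite /sg; case: (c e); last exact: cvg_id.
  by apply: cvgB; [exact: cvg_cst | exact: cvg_id].
- move=> e eE ve /=; rewrite /sg /c ve /=; have [->//|/eqP ne] := eqVneq.
  by have [_ _ /(_ v ve)[//|]] := drawing_ends dr eE; rewrite subr0.
Qed.

(* Only the part of each arc at v up to its last exit from a small ball around
   p v is redrawn, as a radius of that ball; this makes p v accessible although
   the given arcs may spiral around it. *)
Lemma free_segment E v : planar R E ->
  exists p a (s r : R), [/\ plane_drawing E p a, 0 < r, 0 <= s <= 1,
    (forall rho y, 0 < rho <= r -> p y <> p v + rho *: (1, s))
    & (forall rho e t, e \in E -> 0 <= t <= 1 -> 0 < rho <= r ->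
         a e t <> p v + rho *: (1, s))].
Proof.
move=> /(oriented_drawing v)[p [a [dr ca a0]]].
have [ip ha hv hd] := dr.
pose P := p v.
have [r1 r10 r1P] : exists2 r : R, 0 < r & forall y, y != v -> r < `|p y - P|.
  apply: (@common_lower_bound R T (fun y r => y != v -> r < `|p y - P|)).
    by move=> y x z zx xl /xl; apply: le_lt_trans.
  move=> y; have [->|yv] := eqVneq y v; first by exists 1.
  have py : 0 < `|p y - P| by rewrite normr_gt0 subr_eq0 (inj_eq ip).
  by exists (`|p y - P| / 2) => [|_]; lra.
have [r2 r20 r2P] : exists2 r : R, 0 < r &
    forall e, e \in E -> v \notin e -> forall t, 0 <= t <= 1 -> r < `|a e t - P|.
  apply: (@common_lower_bound R _ (fun e r => e \in E -> v \notin e ->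
    forall t, 0 <= t <= 1 -> r < `|a e t - P|)).
    move=> e x z zx xl eE ve t t01; apply: le_lt_trans zx _; exact: xl.
  move=> e; have [/andP[eE ve]|] := boolP ((e \in E) && (v \notin e)); last first.
    by move=> ne; exists 1 => // eE ve; rewrite eE ve in ne.
  have [||r r0 rP] := @positive_lower_bound R (fun t => `|a e t - P|).
  - move=> t; apply: cvg_norm; apply: cvgB; [exact: ca | exact: cvg_cst].
  - move=> t /andP[t0 t1]; rewrite normr_gt0 subr_eq0; apply/eqP.
    have [[y ye ay] [z ze az] _] := drawing_ends dr eE.
    have [t0'|t0'] := eqVneq t 0.
      by rewrite t0' ay => /ip yv; rewrite yv in ye; rewrite ye in ve.
    have [t1'|t1'] := eqVneq t 1.
      by rewrite t1' az => /ip zv; rewrite zv in ze; rewrite ze in ve.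
    by apply: hv; rewrite // !lt_neqAle eq_sym t0' t0 t1' t1.
  by exists r.
(* The ball of radius [r] around [P] contains no other vertex and meets only arcs of edges at
   [v]. *)
pose r := Num.min r1 r2.
have r0 : 0 < r by rewrite lt_min r10.
have rV y : y != v -> r < `|p y - P|.
  by move=> /r1P; apply: le_lt_trans; rewrite ge_min lexx.
have rE e t : e \in E -> v \notin e -> 0 <= t <= 1 -> r < `|a e t - P|.
  by move=> eE ve /(r2P e eE ve t); apply: le_lt_trans; rewrite ge_min lexx orbT.
have [te teP] : exists te : {set T} -> R, forall e, e \in E -> v \in e ->
    [/\ 0 < te e < 1, `|a e (te e) - P| = r
      & forall s, te e < s <= 1 -> r < `|a e s - P|].
  suff /boolp.choice[te teP] : forall e, exists t, e \in E -> v \in e ->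
    [/\ 0 < t < 1, `|a e t - P| = r & forall s, t < s <= 1 -> r < `|a e s - P|].
    by exists te.
  move=> e; have [/andP[eE ve]|] := boolP ((e \in E) && (v \in e)); last first.
    by move=> ne; exists 0 => eE ve; rewrite eE ve in ne.
  have [||t tP] := @last_exit R (fun t => `|a e t - P|) r.
  - move=> t; apply: cvg_norm; apply: cvgB; [exact: ca | exact: cvg_cst].
  - rewrite a0// subrr normr0 r0 /=.
    have [_ [z ze az] _] := drawing_ends dr eE; rewrite az rV//.
    apply/eqP => zv; have [_ ia _] := ha e eE.
    have /eqP : (1 : R) = 0; last by rewrite oner_eq0.
    by apply: ia; rewrite ?in_itv /= ?lexx ?ler01// az a0// zv.
  by exists t.
pose X e := a e (te e).
(* [Num.min] and [Num.max] glue two pieces into one continuous formula: up to time [te e] the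
   straight radius towards [X e], afterwards the old arc. *)
pose a' (e : {set T}) t := if v \in e
  then P + Num.min 1 (t / te e) *: (a e (Num.max t (te e)) - P) else a e t.
(* The two cases are told apart by the distance to [P], at most [r] or greater, so a point of one
   kind never equals a point of the other. *)
have a'P e t : e \in E -> 0 <= t <= 1 ->
    [/\ v \in e, t <= te e, a' e t = P + (t / te e) *: (X e - P)
      & `|a' e t - P| = t / te e * r] \/
    (r < `|a' e t - P| /\ a' e t = a e t).
  move=> eE t01; rewrite /a'; case: ifPn => ve; last by right; rewrite rE.
  have [/andP[te0 te1] teX teO] := teP e eE ve.
  have [tte|tte] := leP t (te e).
    left; rewrite min_r ?ler_pdivrMr ?mul1r// -/(X e); split=> //.
    rewrite [P + _]addrC addrK normrZ teX ger0_norm// divr_ge0 ?(ltW te0)//.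
    by case/andP: t01.
  right; rewrite min_l ?ler_pdivlMr ?mul1r ?(ltW tte)// scale1r [P + _]addrC subrK.
  by rewrite teO// tte; case/andP: t01.
have a'0 e : e \in E -> a' e 0 = a e 0.
  by move=> eE; rewrite /a'; case: ifP => // ve; rewrite mul0r min_r// scale0r addr0 a0.
have a'1 e : e \in E -> a' e 1 = a e 1.
  move=> eE; have [|[ve]|[]//] := a'P e 1 eE; first by rewrite ler01 lexx.
  by have [/andP[_ /lt_geF->]] := teP e eE ve.
(* The norm is the maximum norm, so [(1, s)] has norm 1 for [0 <= s <= 1]. The slope [s] avoids the
   directions of all exit points [X e], hence of all redrawn radii. *)
have [s s01 sP] := exists_notin [seq (X e - P).2 / r | e <- enum E].
have XP e : e \in E -> X e - P <> r *: (1, s).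
  move=> eE eX; case/mapP: sP; exists e; first by rewrite mem_enum.
  by rewrite eX /= mulrC mulKf ?gt_eqF.
have n1s (rho : R) : 0 < rho -> `|rho *: ((1, s) : R * R)| = rho.
  move=> rho0; rewrite normrZ gtr0_norm// prod_normE /= normr1 max_l ?mulr1//.
  by rewrite ger0_norm; case/andP: s01.
exists p, a', s, r; split=> //.
- split=> //.
  + move=> e eE; have [_ ia pa] := ha e eE; split.
    * have cmin : continuous (fun x : R => Num.min 1 (x / te e)).
        apply: continuous_minr => x; first exact: cvg_cst.
        by apply: cvgM; [exact: cvg_id | exact: cvg_cst].
      have cmax : continuous (fun x : R => Num.max x (te e)).
        by apply: continuous_maxr => x; [exact: cvg_id | exact: cvg_cst].
      apply: continuous_subspaceT => t; rewrite /a'; case: (v \in e); last exact: ca.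
      apply: cvgD; first exact: cvg_cst.
      apply: cvgZ; first exact: cmin.
      apply: cvgB; last exact: cvg_cst.
      exact: (continuous_comp (cmax t) (ca e eE _)).
    * move=> t1 t2; rewrite !in_itv => t101 t201 et.
      have [[ve l1 _ n1]|[n1 e1]] := a'P e t1 eE t101;
        have [[ve' l2 _ n2]|[n2 e2]] := a'P e t2 eE t201.
      - have [/andP[te0 _] _ _] := teP e eE ve.
        move: n1; rewrite et n2 => /(mulIf (lt0r_neq0 r0)) /mulIf -> //.
        by rewrite invr_eq0 gt_eqF.
      - have [/andP[te0 _] _ _] := teP e eE ve.
        move: n2; rewrite -et n1 -[X in X < _]mul1r ltr_pM2r// ltNge.
        by rewrite ler_pdivrMr// mul1r l1.
      - have [/andP[te0 _] _ _] := teP e eE ve'.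
        move: n1; rewrite et n2 -[X in X < _]mul1r ltr_pM2r// ltNge.
        by rewrite ler_pdivrMr// mul1r l2.
      - by apply: ia; rewrite ?in_itv// -e1 -e2.
    * by rewrite pa a'0// a'1.
  + move=> e y t eE t01.
    have t01' : 0 <= t <= 1 by case/andP: t01 => /ltW -> /ltW ->.
    have [[ve l1 _ n1]|[_ ->]] := a'P e t eE t01'; last exact: hv.
    have [/andP[te0 _] _ _] := teP e eE ve.
    move=> ay; have [yv|/rV] := eqVneq y v.
      move: n1; rewrite ay yv subrr normr0 => /esym/eqP.
      by rewrite !mulf_eq0 invr_eq0 !gt_eqF//; case/andP: t01.
    by rewrite -ay n1 -[X in X < _]mul1r ltr_pM2r// ltNge ler_pdivrMr// mul1r l1.
  + move=> e f t1 t2 eE fE ef t101 t201 et.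
    have t101' : 0 <= t1 <= 1 by case/andP: t101 => /ltW -> /ltW ->.
    have [[ve l1 e1 n1]|[n1 e1]] := a'P e t1 eE t101';
      have [[vf l2 e2 n2]|[n2 e2]] := a'P f t2 fE t201.
    (* Two radii sharing a point other than the centre coincide, so [X e = X f] would be a common
       point of two original arcs. *)
    * have [te01 _ _] := teP e eE ve; have [tf01 _ _] := teP f fE vf.
      have /andP[te0 _] := te01; have /andP[tf0 tf1] := tf01.
      move: n1; rewrite et n2 => /(mulIf (lt0r_neq0 r0)) tt.
      move: et; rewrite e1 e2 tt => /addrI/scalerI XX.
      have : X e = X f.
        apply: (addIr (- P)); apply: XX; rewrite mulf_neq0//.
          by rewrite gt_eqF//; case/andP: t101.
        by rewrite invr_eq0 gt_eqF.
      by apply: hd => //; rewrite (ltW tf0) (ltW tf1).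
    * have [/andP[te0 _] _ _] := teP e eE ve.
      move: n2; rewrite -et n1 -[X in X < _]mul1r ltr_pM2r// ltNge.
      by rewrite ler_pdivrMr// mul1r l1.
    * have [/andP[te0 _] _ _] := teP f fE vf.
      move: n1; rewrite et n2 -[X in X < _]mul1r ltr_pM2r// ltNge.
      by rewrite ler_pdivrMr// mul1r l2.
    * by move: et; rewrite e1 e2; apply: hd.
- move=> rho y /andP[rho0 rhor] py.
  have pyP : `|p y - P| = rho by rewrite py addrC addKr n1s.
  have [yv|/rV] := eqVneq y v.
    by move: pyP; rewrite yv subrr normr0 => /eqP; rewrite lt_eqF.
  by rewrite pyP ltNge rhor.
- move=> rho e t eE t01 /andP[rho0 rhor] aet.
  have pyP : `|a' e t - P| = rho by rewrite aet addrC addKr n1s.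
  have [[ve l1 e1 n1]|[]] := a'P e t eE t01; last by rewrite pyP ltNge rhor.
  move: aet; rewrite e1 => /addrI; move: n1; rewrite pyP => rhoE; rewrite rhoE.
  rewrite -[in RHS]scalerA => /scalerI XE; apply: (XP e eE); apply: XE.
  by apply: contraTneq rho0; rewrite rhoE => ->; rewrite mul0r ltxx.
Qed.

End Straightening.

(** * Opening a slit plane into a half-plane *)

Section HalfPlane.
Context {R : realType}.
Local Open Scope classical_set_scope.
Local Open Scope ring_scope.

(** With [u] the square root, [(u + a) * (u - a) = b ^+ 2], so a nonzero [u + a] determines [u - a]
    and hence [a]. For [b = 0] both sides are doubles. *)
Lemma slit_injective (a b a' : R) :
  (b = 0 -> 0 <= a) -> (b = 0 -> 0 <= a') ->
  Num.sqrt (a ^+ 2 + b ^+ 2) + a = Num.sqrt (a' ^+ 2 + b ^+ 2) + a' -> a = a'.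
Proof.
have [->|b0] := eqVneq b 0.
  move=> /(_ erefl) a0 /(_ erefl) a'0.
  by rewrite expr0n /= !addr0 !sqrtr_sqr !ger0_norm//; lra.
move=> _ _; set u := Num.sqrt _; set u' := Num.sqrt _ => uE.
have u2 : u ^+ 2 = a ^+ 2 + b ^+ 2 by rewrite sqr_sqrtr// addr_ge0// sqr_ge0.
have u'2 : u' ^+ 2 = a' ^+ 2 + b ^+ 2 by rewrite sqr_sqrtr// addr_ge0// sqr_ge0.
have b2 : 0 < b ^+ 2 by rewrite exprn_even_gt0.
have ua : u + a != 0.
  by apply: contraTneq b2 => ua; have -> : b ^+ 2 = (u + a) * (u - a); [lra|rewrite ua mul0r ltxx].
have : (u + a) * (u - a) = (u + a) * (u' - a').
  have -> : (u + a) * (u - a) = b ^+ 2 by lra.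
  by rewrite uE; lra.
by move/(mulfI ua) => e; lra.
Qed.

Lemma slit_positive (a b : R) :
  b != 0 \/ 0 < a -> 0 < Num.sqrt (a ^+ 2 + b ^+ 2) + a.
Proof.
move=> h; have u0 := sqrtr_ge0 (a ^+ 2 + b ^+ 2).
have [a0|a0] := ltP 0 a; first by lra.
case: h => [b0|]; last by rewrite ltNge a0.
have b2 : 0 < b ^+ 2 by rewrite exprn_even_gt0.
have : Num.sqrt (a ^+ 2) < Num.sqrt (a ^+ 2 + b ^+ 2).
  by rewrite ltr_sqrt; [lra | have := sqr_ge0 a; lra].
by rewrite sqrtr_sqr ler0_norm//; lra.
Qed.

(* Inversion at the far end P + r (1, s) of the segment turns it into a ray
   issuing from the image of P, and (a, b) |-> (sqrt (a^2 + b^2) + a, b) opens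
   the plane slit along the ray a <= 0, b = 0 into the half-plane a > 0. *)
Lemma slit_map (P : R * R) (s r : R) : 0 < r ->
  let D z := forall rho, 0 < rho <= r -> z <> P + rho *: (1, s) in
  exists psi : R * R -> R * R,
    [/\ forall z w, D z -> D w -> psi z = psi w -> z = w,
        forall z, D z -> {for z, continuous psi},
        psi P = 0 & forall z, D z -> z <> P -> 0 < (psi z).1].
Proof.
move=> r0 D.
(* Coordinates centred at the far end and sheared so that the segment lies on the axis [w2 = 0],
   with [P] at [w1 = - r]. *)
pose w1 (z : R * R) : R := z.1 - (P.1 + r).
pose w2 (z : R * R) : R := z.2 - (P.2 + r * s) - s * w1 z.
pose N z := w1 z ^+ 2 + w2 z ^+ 2.
(* The shift by [r^-1] moves the inverted image of [P] to the origin. *)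
pose A z := w1 z / N z + r^-1.
pose B z := w2 z / N z.
pose psi z := (Num.sqrt (A z ^+ 2 + B z ^+ 2) + A z, B z).
have zE (z : R * R) : z = (w1 z + (P.1 + r), w2 z + s * w1 z + (P.2 + r * s)).
  by rewrite {1}[z]surjective_pairing /w2 /w1; congr (_, _); ring.
have onray z : w2 z = 0 -> z = P + (r + w1 z) *: (1, s).
  move=> wz; rewrite {1}[z]zE wz [P]surjective_pairing; congr (_, _) => /=.
    by rewrite /GRing.scale /=; ring.
  by rewrite /GRing.scale /=; ring.
have N0 z : D z -> N z != 0.
  move=> Dz; rewrite paddr_eq0 ?sqr_ge0// !sqrf_eq0; apply/negP => /andP[/eqP e1 /eqP e2].
  by apply: (Dz r); [rewrite r0 lexx | rewrite [LHS]onray// e1 addr0].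
have AB z : D z -> z <> P -> B z != 0 \/ 0 < A z.
  move=> Dz zP; have [B0|] := eqVneq (B z) 0; last by left.
  right; have w20 : w2 z = 0.
    by move/eqP: B0; rewrite mulf_eq0 invr_eq0 (negbTE (N0 z Dz)) orbF => /eqP.
  have zray := onray z w20.
  have w10 : w1 z != 0.
    by have := N0 z Dz; rewrite /N w20 expr0n addr0 sqrf_eq0.
  have AE : A z = (w1 z)^-1 + r^-1.
    by rewrite /A /N w20 expr0n addr0; field; rewrite w10 gt_eqF.
  rewrite AE.
  (* On the line of the segment, [z] is past the far end or before [P]; the slit is excluded by [D],
     and [P] by assumption. *)
  have [w1p|w1n] := ltP 0 (w1 z); first by rewrite addr_gt0 ?invr_gt0.
  have {w1n}w1n : w1 z < 0 by rewrite lt_neqAle w10.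
  have [rw|rw|rw] := ltgtP (r + w1 z) 0.
  - rewrite -[_ + _]opprK -oppr_lt0 opprK opprD -invrN subr_lt0.
    by rewrite ltf_pV2 ?posrE; lra.
  - by case: (Dz (r + w1 z)) => //; rewrite rw; lra.
  - by case: zP; rewrite zray rw scale0r addr0.
have w1P : w1 P = - r by rewrite /w1; ring.
have w2P : w2 P = 0 by rewrite /w2 w1P; ring.
have BP : B P = 0 by rewrite /B w2P mul0r.
have AP : A P = 0 by rewrite /A /N w1P w2P; field; rewrite gt_eqF.
have AB' z : D z -> B z = 0 -> 0 <= A z.
  move=> Dz Bz; have [->|/eqP zP] := eqVneq z P; first by rewrite AP.
  by have [|/ltW//] := AB z Dz zP; rewrite Bz eqxx.
exists psi; split.
- move=> z w Dz Dw [eA eB].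
  have {}eA : A z = A w.
    by apply: (@slit_injective _ (B z)); [exact: AB'|rewrite eB; exact: AB'|rewrite eA eB].
  (* The inverted point has squared length [(N t)^-1], so [A] and [B] determine [N], and then [w1]
     and [w2]. *)
  have NV t : D t -> (N t)^-1 = (A t - r^-1) ^+ 2 + B t ^+ 2.
    move=> Dt; rewrite /A addrK /B !expr_div_n -mulrDl -/(N t).
    by rewrite expr2 invfM mulrA mulfV ?mul1r// N0.
  have eN : N z = N w by apply: invr_inj; rewrite !NV// eA eB.
  have e1 : w1 z = w1 w.
    have : w1 z / N z = w1 w / N w by move: eA; rewrite /A => /addIr.
    by rewrite eN => /mulIf; apply; rewrite invr_eq0 N0.
  have e2 : w2 z = w2 w.
    by move: eB; rewrite /B eN => /mulIf; apply; rewrite invr_eq0 N0.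
  by rewrite [z]zE [w]zE e1 e2.
- move=> z Dz.
  have c1 : {for z, continuous w1}.
    by apply: cvgB; [exact: cvg_fst | exact: cvg_cst].
  have c2 : {for z, continuous w2}.
    apply: cvgB; first by apply: cvgB; [exact: cvg_snd | exact: cvg_cst].
    by apply: cvgM; [exact: cvg_cst | exact: c1].
  have cN : {for z, continuous N}.
    by apply: cvgD; rewrite expr2; apply: cvgM.
  have cA : {for z, continuous A}.
    apply: cvgD; last exact: cvg_cst.
    by apply: cvgM => //; apply: cvgV => //; exact: N0.
  have cB : {for z, continuous B}.
    by apply: cvgM => //; apply: cvgV => //; exact: N0.
  have cS : {for z, continuous (fun z => Num.sqrt (A z ^+ 2 + B z ^+ 2) + A z)}.
    apply: cvgD => //.
    apply: (continuous_comp (f := fun z => A z ^+ 2 + B z ^+ 2)); last exact: sqrt_continuous.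
    by apply: cvgD; rewrite expr2; apply: cvgM.
  exact: (cvg_pair cS cB).
- by rewrite /psi AP BP expr0n !addr0 sqrtr0.
- by move=> z Dz zP; apply: slit_positive; apply: AB.
Qed.

End HalfPlane.

(** * Planarity after joining two separate sides by an edge *)

Section AddEdge.
Context {R : realType} {T : finType}.
Implicit Types (E : {set {set T}}) (p : T -> R * R) (a : {set T} -> R -> R * R).
Local Open Scope classical_set_scope.
Local Open Scope ring_scope.

Lemma halfplane_drawing E v : planar R E ->
  exists p a, [/\ plane_drawing E p a, p v = 0,
    (forall y, y != v -> 0 < (p y).1)
    & (forall e t, e \in E -> 0 < t < 1 -> 0 < (a e t).1)].
Proof.
move=> /(free_segment v)[p [a [s [r [dr r0 _ Dp Da]]]]].
have [psi [ipsi cpsi psi0 psiP]] := slit_map (p v) s r0.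
have [ip ha hv hd] := dr.
exists (psi \o p), (fun e => psi \o a e); split=> //.
- apply: plane_drawing_comp dr _ _ ipsi cpsi.
  + by move=> y rho; apply: Dp.
  + by move=> e t eE t01 rho; apply: Da.
- by move=> y yv; apply: psiP => [rho|/ip/eqP]; [exact: Dp | rewrite (negbTE yv)].
- move=> e t eE t01; apply: psiP => [rho|]; last exact: hv.
  by apply: Da => //; case/andP: t01 => /ltW -> /ltW ->.
Qed.

(** Mirror image of the previous drawing, shifted to leave a strip of width 1 for the new edge. *)
Lemma left_halfplane_drawing E v : planar R E ->
  exists p a, [/\ plane_drawing E p a, p v = (- 1, 0),
    (forall y, y != v -> (p y).1 < - 1)
    & (forall e t, e \in E -> 0 < t < 1 -> (a e t).1 < - 1)].
Proof.
move=> pE; have [p2' [a2' [dr2' p2v' p2P' a2P']]] := halfplane_drawing v pE.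
pose refl (z : R * R) : R * R := (- 1 - z.1, z.2).
pose p2 := refl \o p2'; pose a2 e := refl \o a2' e.
have dr2 : plane_drawing E p2 a2.
  apply: (plane_drawing_comp (D := fun=> True)) dr2' _ _ _ _ => //.
    by move=> [b c] [b' c'] _ _ [] /addrI/oppr_inj -> ->.
  move=> z _.
  have c1 : {for z, continuous (fun z : R * R => - 1 - z.1)}.
    by apply: cvgB; [exact: cvg_cst | exact: cvg_fst].
  have c2 : {for z, continuous (snd : R * R -> R)} by exact: cvg_snd.
  exact: (cvg_pair c1 c2).
have p2v : p2 v = (- 1, 0) by rewrite /p2 /refl /= p2v' subr0.
have p2P y : y != v -> (p2 y).1 < - 1 by move=> /p2P'; rewrite /p2 /=; lra.
have a2P e t : e \in E -> 0 < t < 1 -> (a2 e t).1 < - 1.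
  by move=> eE /(a2P' e t eE); rewrite /a2 /=; lra.
by exists p2, a2.
Qed.

(** The part inside [C] is drawn on the right with [x] at the origin, the rest on the left with [v]
    at [(- 1, 0)]; the new edge is the segment between these points. *)
Lemma planar_add_edge E (C : {set T}) x v : planar R E ->
  (forall e, e \in E -> e \subset C \/ e \subset ~: C) ->
  x \in C -> v \notin C -> planar R ([set x; v]%SET |: E).
Proof.
move=> pE EC xC vC.
have [p1 [a1 [dr1 p1x p1P a1P]]] := halfplane_drawing x pE.
have [p2 [a2 [dr2 p2v p2P a2P]]] := left_halfplane_drawing v pE.
have p1P' y : 0 <= (p1 y).1.
  by have [->|/p1P/ltW//] := eqVneq y x; rewrite p1x.
have p2P'' y : (p2 y).1 <= - 1.
  by have [->|/p2P/ltW//] := eqVneq y v; rewrite p2v.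
have cl (p : T -> R * R) a (Q : R -> Prop) e t : plane_drawing E p a -> e \in E ->
    (forall y, Q (p y).1) -> (forall t, 0 < t < 1 -> Q (a e t).1) ->
    0 <= t <= 1 -> Q (a e t).1.
  move=> dr eE Qp Qa /andP[t0 t1]; have [[y _ ay] [z _ az] _] := drawing_ends dr eE.
  have [->|t0'] := eqVneq t 0; first by rewrite ay.
  have [->|t1'] := eqVneq t 1; first by rewrite az.
  by apply: Qa; rewrite !lt_neqAle eq_sym t0' t0 t1' t1.
have a1P'' e t : e \in E -> 0 <= t <= 1 -> 0 <= (a1 e t).1.
  move=> eE; apply: (cl p1 a1 (fun u => 0 <= u) e t dr1 eE p1P') => u u01.
  by rewrite ltW// a1P.
have a2P'' e t : e \in E -> 0 <= t <= 1 -> (a2 e t).1 <= - 1.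
  move=> eE; apply: (cl p2 a2 (fun u => u <= - 1) e t dr2 eE p2P'') => u u01.
  by rewrite ltW// a2P.
(* An edge has a drawn end, so it is nonempty and cannot lie both in [C] and in its complement. *)
have EC' e : e \in E -> (e \subset C) = ~~ (e \subset ~: C).
  move=> eE; have [[y ye _] _ _] := drawing_ends dr1 eE.
  apply/idP/idP => [/fintype.subsetP/(_ y ye) yC|].
    by apply/negP => /fintype.subsetP/(_ y ye); rewrite inE yC.
  by case: (EC e eE) => // ->.
have xvC : ([set x; v]%SET \subset C) = false.
  by apply/negP => /fintype.subsetP/(_ v); rewrite !inE eqxx orbT (negbTE vC) => /(_ isT).
have xvC' : ([set x; v]%SET \subset ~: C) = false.
  by apply/negP => /fintype.subsetP/(_ x); rewrite !inE eqxx xC => /(_ isT).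
pose p y := if y \in C then p1 y else p2 y.
pose a (e : {set T}) (t : R) : R * R := if e \subset C then a1 e t
  else if e \subset ~: C then a2 e t else (- t, 0).
have kind e : e \in [set x; v]%SET |: E ->
   [\/ e = [set x; v]%SET /\ a e = fun t => (- t, 0),
       [/\ e \in E, e \subset C & a e = a1 e]
     | [/\ e \in E, e \subset ~: C & a e = a2 e]].
  rewrite in_setU1 => /orP[/eqP ->|eE].
    by constructor 1; split=> //; apply/funext => t; rewrite /a xvC xvC'.
  case: (EC e eE) => eC; [constructor 2 | constructor 3]; split=> //.
    by apply/funext => t; rewrite /a eC.
  by apply/funext => t; rewrite /a eC EC'// eC.
have [ip1 ha1 hv1 hd1] := dr1; have [ip2 ha2 hv2 hd2] := dr2.
(* Different pieces are kept apart by first coordinates alone, the interior of the new edge lying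
   strictly between [- 1] and [0]. *)
have fstE (z w : R * R) : z = w -> z.1 <= w.1 <= z.1 by move=> ->; rewrite lexx.
exists p, a; split.
- move=> y z; rewrite /p; case: ifP => yC; case: ifP => zC.
  + exact: ip1.
  + by move=> /fstE h; exfalso; move: h; have := p1P' y; have := p2P'' z; lra.
  + by move=> /fstE h; exfalso; move: h; have := p1P' z; have := p2P'' y; lra.
  + exact: ip2.
- move=> e /kind[[-> ->]|[eE eC ->]|[eE eC ->]]; split.
  + apply: continuous_subspaceT => t.
    have c1 : {for t, continuous (-%R : R -> R)} by apply: cvgN; exact: cvg_id.
    have c2 : {for t, continuous (cst 0 : R -> R)} by exact: cvg_cst.
    exact: (cvg_pair c1 c2).
  + by move=> s t _ _ [] /oppr_inj.
  + rewrite oppr0; apply/seteqP; split=> [z [y /=]|z].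
      rewrite !inE => /orP[/eqP ->|/eqP ->] <-; rewrite /p.
        by left; rewrite xC p1x.
      by right; rewrite (negbTE vC) p2v.
    case=> ->; [exists x => /=; first by rewrite !inE eqxx
               | exists v => /=; first by rewrite !inE eqxx orbT]; rewrite /p.
      by rewrite xC p1x.
    by rewrite (negbTE vC) p2v.
  + by have [] := ha1 e eE.
  + by have [] := ha1 e eE.
  + have [_ _ <-] := ha1 e eE; apply: eq_imagel => y /= ye.
    by rewrite /p (fintype.subsetP eC y ye).
  + by have [] := ha2 e eE.
  + by have [] := ha2 e eE.
  + have [_ _ <-] := ha2 e eE; apply: eq_imagel => y /= ye.
    by have := fintype.subsetP eC y ye; rewrite /p inE => /negbTE ->.
- move=> e y t /kind[[-> ->]|[eE eC ->]|[eE eC ->]] t01; rewrite /p; case: ifP => yC.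
  + by move/fstE => /=; have := p1P' y; lra.
  + by move/fstE => /=; have := p2P'' y; lra.
  + exact: hv1.
  + by move/fstE => /=; have := p2P'' y; have := a1P e t eE t01; lra.
  + by move/fstE => /=; have := p1P' y; have := a2P e t eE t01; lra.
  + exact: hv2.
- move=> e f s t /kind[[-> ->]|[eE eC ->]|[eE eC ->]]
    /kind[[-> ->]|[fE fC ->]|[fE fC ->]] ef s01 t01.
  + by rewrite eqxx in ef.
  + by move/fstE => /=; have := a1P'' f t fE t01; lra.
  + by move/fstE => /=; have := a2P'' f t fE t01; lra.
  + by move/fstE => /=; have := a1P e s eE s01; lra.
  + exact: hd1.
  + by move/fstE => /=; have := a1P e s eE s01; have := a2P'' f t fE t01; lra.
  + by move/fstE => /=; have := a2P e s eE s01; lra.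
  + by move/fstE => /=; have := a2P e s eE s01; have := a1P'' f t fE t01; lra.
  + exact: hd2.
Qed.

End AddEdge.

(** * Cyclic edges and switches *)

Section Switching.
Variable T : finType.
Implicit Types (E H : {set {set T}}) (x y v a b : T) (t : T * T * T).
Local Open Scope set_scope.

Lemma adj_symmetric E : symmetric (adj E).
Proof. by move=> x y; rewrite /adj /= finset.setUC. Qed.

Lemma connect_adjC E : connect_sym (adj E).
Proof. exact: sym_connect_sym (adj_symmetric E). Qed.

Lemma connect_adjS E H x y :
  E \subset H -> connect (adj E) x y -> connect (adj H) x y.
Proof.
move=> /fintype.subsetP sEH; apply: connect_sub => a b ab.
by apply: connect1; apply: sEH.
Qed.

Lemma componentS E H x : E \subset H -> component E x \subset component H x.
Proof.
move=> sEH; apply/fintype.subsetP => y; rewrite !inE; exact: connect_adjS.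
Qed.

Lemma set2_eq a b x y :
  [set a; b] = [set x; y] -> a = x /\ b = y \/ a = y /\ b = x.
Proof.
move=> e.
have : a \in [set x; y] by rewrite -e !inE eqxx.
have : b \in [set x; y] by rewrite -e !inE eqxx orbT.
have : x \in [set a; b] by rewrite e !inE eqxx.
have : y \in [set a; b] by rewrite e !inE eqxx orbT.
rewrite !inE => /orP[]/eqP ? /orP[]/eqP ? /orP[]/eqP ? /orP[]/eqP ?; subst; auto.
Qed.

(** A walk can be shortened so that it uses [xv] at most once, in one of the two directions. *)
Lemma connect_add_edge H x v a b : connect (adj ([set x; v] |: H)) a b ->
  [\/ connect (adj H) a b,
      connect (adj H) a x /\ connect (adj H) v b
    | connect (adj H) a v /\ connect (adj H) x b].
Proof.
move=> /connectP[p pp ->]; elim: p a pp => [|c p IH] a /=.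
  by constructor 1; exact: connect0.
case/andP=> ac /IH {IH}.
have /finset.setU1P[/set2_eq acxv|{}ac] : [set a; c] \in [set x; v] |: H := ac.
  by case: acxv => -[-> ->] []; [by constructor 2 | by case; constructor 2
    | by case; constructor 1 | by constructor 3 | by case; constructor 1
    | by case; constructor 3].
case.
- by constructor 1; apply: connect_trans (connect1 _) _; first exact: ac.
- by case=> cx vb; constructor 2; split=> //; apply: connect_trans (connect1 _) cx.
- by case=> cx vb; constructor 3; split=> //; apply: connect_trans (connect1 _) cx.
Qed.

(* The edges lying on a cycle of a component of order at most k, with both
   orientations. *)
Definition cyclic_arcs (k : nat) E : {set T * T} :=
  [set p : T * T | [&& [set p.1; p.2] \in E, #|component E p.1| <= k
    & connect (adj (E :\ [set p.1; p.2])) p.1 p.2]].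

(** The first edge [xy] of a cycle gives a cyclic arc: the rest of the cycle leads from [y] back to
    [x] without it. *)
Lemma no_cyclic_arc k E :
  #|cyclic_arcs k E| = 0 -> ~ has_small_cyclic_component k E.
Proof.
move=> /finset.cards0_eq D0 [z [zk [[|x [|y [|c q]]] [// _ uq cy sub]]]].
have : (x, y) \in cyclic_arcs k E; last by rewrite D0 inE.
move: cy uq sub => /= /and3P[xy yc cq] /and4P[x1 y1 c1 uq] sub.
have zx : connect (adj E) z x by have := sub x; rewrite !inE eqxx => /(_ isT).
rewrite inE /= [_ \in E]xy /=; apply/andP; split.
  rewrite (_ : component E x = component E z) //.
  by apply/setP => w; rewrite !inE (same_connect (connect_adjC E) zx).
have yc' : adj (E :\ [set x; y]) y c.
  rewrite /adj /= in_setD1 [_ \in E]yc andbT; apply/negP => /eqP/set2_eq.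
  move: x1 y1; rewrite !inE !negb_or => /and3P[_ /eqP xc _] /andP[/eqP yc0 _].
  by case=> -[? ?]; congruence.
(* This path never returns to [y], so none of its edges is [xy]. *)
have cq' : path (adj (E :\ [set x; y])) c (rcons q x).
  apply: (sub_in_path (P := predC1 y) _ _ cq).
    move=> a b; rewrite !inE => /negPf ay /negPf by_ ab.
    rewrite /adj /= in_setD1 [_ \in E]ab andbT; apply/negP => /eqP/set2_eq.
    by case=> -[e1 e2]; rewrite ?e1 ?e2 eqxx in ay by_.
  move: x1 y1; rewrite !inE !negb_or /= all_rcons => /and3P[xy' _ _] /andP[yc0 yq].
  rewrite /= eq_sym yc0 xy' /=; apply/allP => w wq /=.
  by apply: contraNneq yq => <-.
rewrite connect_adjC; apply: connect_trans (connect1 yc') _.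
by apply/connectP; exists (rcons q x); rewrite ?last_rcons.
Qed.

Definition switch E t : {set {set T}} :=
  [set t.1.1; t.2] |: (E :\ [set t.1.1; t.1.2]).

Definition switchable k E : {set T * T * T} :=
  [set t | (t.1 \in cyclic_arcs k E) && (t.2 \notin component E t.1.1)].

(** With [t] read as [((x, y), v)], a superset of the switches that can have produced [E]; [C] is
    the side of [x] once [xv] is cut. *)
Definition switch_traces k E : {set T * T * T} :=
  [set t | let C := component (E :\ [set t.1.1; t.2]) t.1.1 in
    [&& [set t.1.1; t.2] \in E, #|C| <= k, t.1.2 \in C & t.2 \notin C]].

Section OneSwitch.
Variables (k : nat) (E : {set {set T}}) (x y v : T).
Hypotheses (simE : simple_graph E) (xyv : (x, y, v) \in switchable k E).

Let xyE : [set x; y] \in E.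
Proof. by move: xyv; rewrite !inE /= => /andP[/and3P[]]. Qed.

Let xk : #|component E x| <= k.
Proof. by move: xyv; rewrite !inE /= => /andP[/and3P[]]. Qed.

Let xy_conn : connect (adj (E :\ [set x; y])) x y.
Proof. by move: xyv; rewrite !inE /= => /andP[/and3P[]]. Qed.

Let xvN : ~~ connect (adj E) x v.
Proof. by move: xyv; rewrite !inE /= => /andP[/and3P[]]. Qed.

Let xvE : [set x; v] \notin E.
Proof. by apply: contra xvN => xv; apply: connect1. Qed.

Let sub_E : E :\ [set x; y] \subset E.
Proof. exact: finset.subD1set. Qed.

Let xvD : [set x; v] \notin E :\ [set x; y].
Proof. by apply: contra xvE; apply: (fintype.subsetP sub_E). Qed.

Lemma switch_simple : simple_graph (switch E (x, y, v)).
Proof.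
apply/forallP => e; apply/implyP; rewrite in_setU1 => /orP[/eqP ->|].
  by rewrite cards2 /=; have [xv|//] := eqVneq x v; case/negP: xvN; rewrite xv.
by move=> /(fintype.subsetP sub_E) eE; move/forallP/(_ e)/implyP: simE; apply.
Qed.

Lemma card_switch : #|switch E (x, y, v)| = #|E|.
Proof. by rewrite cardsU1 xvD (cardsD1 [set x; y] E) xyE. Qed.

Lemma switch_planar (R : realType) : planar R E -> planar R (switch E (x, y, v)).
Proof.
move=> pE; apply: (planar_add_edge (C := component E x)).
- exact: planar_sub sub_E pE.
- move=> e eD; have eE := fintype.subsetP sub_E e eD.
  have /forallP/(_ e)/implyP/(_ eE)/cards2P[a [b [_ eab]]] := simE.
  have ab : connect (adj E) a b by apply: connect1; rewrite /adj /= -eab.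
  have xab := same_connect_r (connect_adjC E) ab x.
  have [xa|xa] := boolP (connect (adj E) x a); [left | right];
    by apply/fintype.subsetP => w; rewrite eab !inE => /orP[]/eqP ->; rewrite -?xab.
- by rewrite inE connect0.
- by rewrite inE.
Qed.

Lemma switch_trace : (x, y, v) \in switch_traces k (switch E (x, y, v)).
Proof.
rewrite inE /= (_ : switch E _ :\ _ = E :\ [set x; y]); last first.
  exact: setU1K xvD.
rewrite setU11 /= !inE xy_conn /=; apply/andP; split.
  exact: leq_trans (subset_leq_card (componentS x sub_E)) xk.
by apply: contra xvN; apply: connect_adjS.
Qed.

(** For a fixed triple the switch can be undone, which makes it injective in the graph. *)
Lemma switchK : [set x; y] |: (switch E (x, y, v) :\ [set x; v]) = E.
Proof. by rewrite (setU1K xvD) finset.setD1K. Qed.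

(** The arc [(x, y)] is lost, and none is gained because [xv] is a bridge of the new graph. *)
Lemma card_cyclic_arcs_switch :
  #|cyclic_arcs k (switch E (x, y, v))| < #|cyclic_arcs k E|.
Proof.
set H := switch E (x, y, v).
have subH : E :\ [set x; y] \subset H by exact: finset.subsetUr.
have vy : v != y.
  by apply: contraNneq xvN => ->; apply: connect_adjS sub_E xy_conn.
apply: proper_card; apply/properP; split; last first.
  exists (x, y); first by move: xyv; rewrite !inE /= => /andP[].
  rewrite !inE eqxx /= orbF; apply/negP => /and3P[/eqP/set2_eq[[_ /eqP]|[]]].
    by rewrite eq_sym (negbTE vy).
  move=> xv; move: xvN; rewrite xv connect0 //.
apply/fintype.subsetP => -[a b]; rewrite !inE /= => /and3P[abH ak abc].
have xvN' : ~~ connect (adj (E :\ [set x; y])) x v.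
  by apply: contra xvN; apply: connect_adjS.
have abD : [set a; b] \in E :\ [set x; y].
  case/orP: abH => [/eqP abxv|]; last by rewrite in_setD1.
  have HE : H :\ [set a; b] = E :\ [set x; y] by rewrite abxv; exact: setU1K xvD.
  case/negP: xvN'; move: abc; rewrite HE.
  by case: (set2_eq abxv) => -[-> ->] //; rewrite connect_adjC.
have abE := fintype.subsetP sub_E _ abD.
rewrite abE /=; apply/andP; split.
  (* A path of [E - xy] bypasses the deleted edge, so the component of [a] in [E] lies inside its
     component in [H]. *)
  apply: leq_trans ak; apply: subset_leq_card; apply/fintype.subsetP => w.
  rewrite !inE; apply: connect_sub => c d cd.
  have [cdxy|cdxy] := eqVneq [set c; d] [set x; y].
    have xyH := connect_adjS subH xy_conn.
    by case: (set2_eq cdxy) => -[-> ->] //; rewrite connect_adjC.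
  by apply: connect1; apply: (fintype.subsetP subH); rewrite in_setD1 cdxy.
have subab : E :\ [set x; y] :\ [set a; b] \subset E :\ [set a; b].
  exact: finset.setSD.
have subxy : E :\ [set x; y] :\ [set a; b] \subset E :\ [set x; y].
  exact: finset.subD1set.
have abxy : connect (adj (E :\ [set x; y])) a b by apply: connect1.
have HE : H :\ [set a; b] = [set x; v] |: (E :\ [set x; y] :\ [set a; b]).
  rewrite /H /switch /=; apply/setP => e; rewrite !inE.
  case: (eqVneq e [set x; v]) => [->|] //=; rewrite andbT.
  by apply: contraNneq xvD => ->.
(* A detour for [ab] through [xv], closed up by [ab] itself, would join [x] to [v] within
   [E - xy]. *)
move: abc; rewrite HE => /connect_add_edge[|[ax vb]|[av xb]].
- exact: connect_adjS.
- case/negP: xvN'; rewrite connect_adjC; apply: connect_trans (connect_adjS subxy vb) _.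
  by rewrite connect_adjC; apply: connect_trans abxy; rewrite connect_adjC; apply: connect_adjS ax.
- case/negP: xvN'; apply: connect_trans (connect_adjS subxy xb) _.
  by rewrite connect_adjC in abxy; apply: connect_trans abxy (connect_adjS subxy av).
Qed.

End OneSwitch.

End Switching.

(** * Double counting of switches *)

Section Counting.
Local Open Scope set_scope.

Lemma card_dependent_pairs (A B : finType) (S : {set A * B}) :
  #|S| = \sum_a #|[set b | (a, b) \in S]|.
Proof.
rewrite -sum1_card (eq_bigr (fun a => \sum_(b | (a, b) \in S) 1)); last first.
  by move=> a _; rewrite -sum1_card; apply: eq_bigl => b; rewrite inE.
by rewrite pair_big_dep; apply: eq_bigl => -[a b].
Qed.

Lemma sum_card_exchange (A B : finType) (S : {set A}) (V : A -> {set B}) :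
  \sum_(a in S) #|V a| = \sum_b #|[set a in S | b \in V a]|.
Proof.
under eq_bigr do rewrite -sum1_card.
rewrite (exchange_big_dep predT) //=; apply: eq_bigr => b _.
by rewrite -sum1_card; apply: eq_bigl => a; rewrite inE.
Qed.

(** Markov's inequality: at most half of [S] exceeds twice the bound [c] on the mean. *)
Lemma markov_card (U : finType) (S : {set U}) (d : U -> nat) c :
  \sum_(u in S) d u <= c * #|S| -> #|S| <= 2 * #|[set u in S | d u <= c.*2]|.
Proof.
move=> dS.
have : #|S| = #|[set u in S | d u <= c.*2]| + #|[set u in S | c.*2 < d u]|.
  rewrite -(cardsID [set u | d u <= c.*2] S); congr (_ + _); apply: eq_card => u.
    by rewrite !inE.
  by rewrite !inE -ltnNge andbC.
have : #|[set u in S | c.*2 < d u]| * c.*2.+1 <= \sum_(u in S) d u.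
  rewrite -sum_nat_const [leqRHS](bigID (fun u => c.*2 < d u)) /=.
  apply: leq_trans (leq_addr _ _); rewrite [leqRHS](eq_bigl (mem [set u in S | c.*2 < d u])).
    by apply: leq_sum => u; rewrite inE => /andP[].
  by move=> u /=; rewrite inE.
nia.
Qed.

(** Each new level multiplies the cumulative count by at most [c + 1]. *)
Lemma geometric_card (U : finType) (S : {set U}) (d : U -> nat) c :
  (forall i, #|[set u in S | d u == i.+1]| <= c * #|[set u in S | d u <= i]|) ->
  forall i, #|[set u in S | d u <= i]| <= c.+1 ^ i * #|[set u in S | d u <= 0]|.
Proof.
move=> step; elim=> [|i IH]; first by rewrite mul1n.
have : #|[set u in S | d u <= i.+1]| <=
    #|[set u in S | d u <= i]| + #|[set u in S | d u == i.+1]|.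
  apply: leq_trans (leq_card_setU _ _); apply: subset_leq_card.
  by apply/fintype.subsetP => u; rewrite !inE leq_eqVlt ltnS => /andP[-> /orP[]->]; rewrite ?orbT.
by have := step i; rewrite expnS; nia.
Qed.

Variables (T : finType) (k : nat).
Implicit Types (E H : {set {set T}}).

Lemma card_switchable E :
  #|cyclic_arcs k E| * (#|T| - k) <= #|switchable k E|.
Proof.
rewrite [leqRHS]card_dependent_pairs -sum_nat_const.
rewrite [leqRHS](bigID (mem (cyclic_arcs k E))) /=; apply: leq_trans (leq_addr _ _).
apply: leq_sum => p pE.
have pk : #|component E p.1| <= k by move: pE; rewrite inE => /and3P[].
rewrite (_ : [set b | _] = ~: component E p.1); last first.
  by apply/setP => v; rewrite inE [in LHS]inE /= pE finset.in_setC.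
by rewrite cardsCs finset.setCK leq_sub2l.
Qed.

(* If two vertices v, w are both possible ends of the inserted edge at x, then
   the edge xw survives the deletion of xv, so that w lies in the small part
   cut off by xv. *)
Lemma card_switch_ends H x :
  #|[set v | let C := component (H :\ [set x; v]) x in
      [&& [set x; v] \in H, #|C| <= k & v \notin C]]| <= k.+1.
Proof.
set W := finset _; have [->|[v vW]] := set_0Vmem W; first by rewrite cards0.
move: (vW); rewrite inE => /and3P[_ vk _].
apply: leq_trans (_ : #|v |: component (H :\ [set x; v]) x| <= _); last first.
  by rewrite cardsU1; case: (_ \notin _); rewrite ?add1n ?add0n ?ltnS// leqW.
apply: subset_leq_card; apply/fintype.subsetP => w; rewrite inE => /and3P[wH _ wC].
rewrite !inE; have [//|wv] := eqVneq w v.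
apply: connect1; rewrite /adj /= in_setD1 wH andbT.
apply/negP => /eqP/set2_eq[[_ wv']|[xv wx]]; first by rewrite wv' eqxx in wv.
by rewrite wx xv eqxx in wv.
Qed.

Lemma card_switch_traces H : #|switch_traces k H| <= #|T| * (k.+1 * k).
Proof.
(* Reordered as [((x, v), y)], since the range of [y] depends on the pair [(x, v)]. *)
pose f (t : T * T * T) := (t.1.1, t.2, t.1.2).
have fI : injective f by move=> [[? ?] ?] [[? ?] ?] [-> -> ->].
rewrite -(card_imset _ fI) [leqLHS]card_dependent_pairs.
pose W := [set q : T * T | let C := component (H :\ [set q.1; q.2]) q.1 in
      [&& [set q.1; q.2] \in H, #|C| <= k & q.2 \notin C]].
apply: (@leq_trans (\sum_(q in W) k)).
  rewrite [leqLHS](bigID (mem W)) /= [X in _ + X]big1 ?addn0 => [|q qW].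
    apply: leq_sum => q; rewrite inE => /and3P[qH qk qC].
    apply: leq_trans qk; apply: subset_leq_card; apply/fintype.subsetP => y.
    by rewrite inE => /imsetP[[[a b] c]]; rewrite inE /= => /and4P[_ _ bC _] [-> ->].
  apply: eq_card0 => y; rewrite inE; apply/negP => /imsetP[[[a b] c]].
  rewrite inE /= => /and4P[h1 h2 h3 h4] [qE _]; case/negP: qW.
  by rewrite qE inE /= h1 h2.
rewrite sum_nat_const mulnA leq_mul2r; apply/orP; right.
rewrite [leqLHS]card_dependent_pairs -sum_nat_const; apply: leq_sum => x _.
rewrite (eq_card (B := [set v | let C := component (H :\ [set x; v]) x in
      [&& [set x; v] \in H, #|C| <= k & v \notin C]])); first exact: card_switch_ends.
by move=> v; rewrite !inE.
Qed.

(** Kept general in [A] and [B] to serve twice: for all planar graphs, and from one level of cyclic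
    arcs to the levels below. *)
Lemma switching_count (A B : {set {set {set T}}}) :
  (forall E, E \in A -> simple_graph E) ->
  (forall E t, E \in A -> t \in switchable k E -> switch E t \in B) ->
  (\sum_(E in A) #|cyclic_arcs k E|) * (#|T| - k) <= #|B| * (#|T| * (k.+1 * k)).
Proof.
move=> simA swAB; rewrite big_distrl /=.
apply: (@leq_trans (\sum_(E in A) #|switchable k E|)).
  by apply: leq_sum => E _; exact: card_switchable.
apply: (@leq_trans (\sum_(H in B) #|switch_traces k H|)); last first.
  rewrite -(sum_nat_const (mem B)); apply: leq_sum => H _.
  exact: card_switch_traces.
(* For each triple, switching maps its sources in [A] injectively to the graphs in [B] that have it
   as a trace. *)
rewrite !sum_card_exchange; apply: leq_sum => -[[x y] v] _.
rewrite -(@card_in_imset _ _ (fun E => switch E (x, y, v))); last first.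
  move=> E E'; rewrite inE => /andP[EA Es]; rewrite inE => /andP[E'A E's] eq_sw.
  by rewrite -(switchK Es) eq_sw (switchK E's).
apply: subset_leq_card; apply/fintype.subsetP => H /imsetP[E].
rewrite inE => /andP[EA Es] ->.
by rewrite inE swAB //=; apply: switch_trace Es.
Qed.

End Counting.

(** * A positive proportion without cyclic arcs, and the limit superior *)

Section Main.
Variable R : realType.

Lemma switch_planar_graphs k n m E t :
  E \in planar_graphs R n m -> t \in switchable k E ->
  switch E t \in planar_graphs R n m.
Proof.
case: t => [[x y] v]; rewrite inE => /and3P[simE /eqP mE /asboolP pE] sw.
rewrite inE.
rewrite (switch_simple simE sw) (card_switch sw) mE eqxx /=.
by apply/asboolP; apply: (switch_planar simE sw).
Qed.

Lemma proportion_without_small_cyclic_component k n m : (0 < n)%N -> (k.*2 <= n)%N ->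
  (#|planar_graphs R n m| <= 2 * (2 * (k.+1 * k)).+1 ^ (2 * (k.+1 * k)).*2 *
     #|[set E in planar_graphs R n m | ~~ `[< has_small_cyclic_component k E >]]%SET|)%N.
Proof.
(* The factor 2 in [K] absorbs [n / (n - k)], which is at most 2 once [n] is at least [2 k]. *)
move=> n0 kn; set S := planar_graphs R n m; set K := (2 * (k.+1 * k))%N.
pose d (E : {set {set 'I_n}}) := #|cyclic_arcs k E|.
have simS (A : {set {set {set 'I_n}}}) : A \subset S ->
    forall E, E \in A -> simple_graph E.
  by move=> /fintype.subsetP AS E /AS; rewrite inE => /and3P[].
have count (A B : {set {set {set 'I_n}}}) : A \subset S ->
    (forall E t, E \in A -> t \in switchable k E -> switch E t \in B) ->
    (\sum_(E in A) d E <= K * #|B|)%N.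
  move=> AS AB; have := switching_count (simS A AS) AB.
  have nk0 : (0 < n - k)%N by lia.
  rewrite card_ord => h; rewrite -(leq_pmul2r nk0); apply: leq_trans h _.
  have -> : (K * #|B| * (n - k) = #|B| * (2 * (n - k) * (k.+1 * k)))%N by rewrite /K; ring.
  by rewrite leq_mul2l leq_mul2r; apply/orP; right; apply/orP; right; lia.
have dS : (\sum_(E in S) d E <= K * #|S|)%N.
  by apply: count => // E t; exact: switch_planar_graphs.
(* Half of the graphs have at most [2 K] cyclic arcs; descending from there to level 0 costs a
   factor [K + 1] per level. *)
apply: leq_trans (markov_card dS) _; rewrite -mulnA leq_mul2l /=.
apply: leq_trans (geometric_card _ _) _.
  move=> i; pose A := [set E in S | d E == i.+1]%SET.
  (* Each graph of [A] contributes [i + 1], hence at least 1, to this sum. *)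
  apply: (@leq_trans (\sum_(E in A) d E)%N).
    by rewrite -sum1_card; apply: leq_sum => E; rewrite inE => /andP[_ /eqP ->].
  apply: count => [|E [[x y] v]].
    by apply/fintype.subsetP => E; rewrite inE => /andP[].
  rewrite inE => /andP[ES /eqP dE] sw.
  rewrite inE (switch_planar_graphs ES sw) /= -ltnS -dE.
  exact: card_cyclic_arcs_switch sw.
rewrite leq_mul2l; apply/orP; right; apply: subset_leq_card.
apply/fintype.subsetP => E; rewrite !inE leqn0 => /andP[-> /eqP dE] /=.
by apply/asboolPn; exact: no_cyclic_arc.
Qed.

End Main.

(** The tail from [N] is one of the sets over whose suprema [limn_esup] takes the infimum. *)
Lemma limn_esup_le_from (R : realType) (u : nat -> \bar R) (l : \bar R) (N : nat) :
  (forall n, (N <= n)%N -> (u n <= l)%E) -> (limn_esup u <= l)%E.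
Proof.
move=> ul; apply: (@le_trans _ _ (ereal_sup (u @` [set n | (N <= n)%N]))%classic).
  by apply: ereal_inf_lbound; exists [set n | (N <= n)%N]%classic => //; exists N.
by apply: ge_ereal_sup => _ [n nN <-]; apply: ul.
Qed.

Lemma prob_unif_le (R : realType) (U : finType) (S : {set U}) (Q : U -> Prop) (c : nat) :
  (0 < c)%N -> (#|S| <= c * #|[set u in S | ~~ `[< Q u >]]%SET|)%N ->
  (prob_unif R S Q <= 1 - c%:R^-1)%R.
Proof.
move=> c0; rewrite /prob_unif; set A := [set u in S | `[< Q u >]]%SET.
set B := finset _ => SB.
have SE : (#|S| = #|A| + #|B|)%N.
  rewrite -(cardsID [set u | `[< Q u >]]%SET S); congr (_ + _)%N; apply: eq_card => u.
    by rewrite !inE.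
  by rewrite !inE andbC.
(* For empty [S] the quotient is 0 by convention, and the bound is nonnegative since [c >= 1]. *)
have [S0|S0] := posnP #|S|.
  by rewrite S0 invr0 mulr0 subr_ge0 invf_le1 ?ltr0n// ler1n.
have c0' : (0 < c%:R :> R)%R by rewrite ltr0n.
have -> : (1 - c%:R^-1 = (c%:R - 1) / c%:R :> R)%R by rewrite mulrBl mulfV ?gt_eqF ?mul1r.
rewrite ler_pdivrMr ?ltr0n// mulrAC ler_pdivlMr// mulrBl mul1r.
move: SB; rewrite -(ler_nat R) natrM SE natrD; lra.
Qed.

Theorem theorem8p3 (R : realType) (k : nat) (m : nat -> nat) :
  (limn_esup (fun n : nat =>
     (prob_unif R (planar_graphs R n (m n))
        (has_small_cyclic_component k))%:E) < 1)%E.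
Proof.
pose c : nat := 2 * (2 * (k.+1 * k)).+1 ^ (2 * (k.+1 * k)).*2.
have c0 : (0 < c)%N by rewrite muln_gt0 /= expn_gt0.
apply: (@le_lt_trans _ _ (1 - c%:R^-1 : R)%R%:E); last first.
  by rewrite lte_fin ltrBlDr ltrDl invr_gt0 ltr0n.
(* Starting at [2 k + 1] gives both [2 k <= n] and [0 < n], even for [k = 0]. *)
apply: (limn_esup_le_from (N := (k.*2).+1)) => n nk.
rewrite lee_fin; apply: prob_unif_le => //.
apply: proportion_without_small_cyclic_component; last exact: ltnW.
exact: leq_ltn_trans (leq0n _) nk.
Qed.
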